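(* For every $n\geq 3$, the prism graph $\Pi_n$ is equitably 3-choosable.
   Context: The prism graph $\Pi_n$ ($n\ge 3$) is the Cartesian product $C_n \square K_2$: it has vertices $u_1,\dots,u_n,v_1,\dots,v_n$ and edges $u_iu_{i+1}$, $v_iv_{i+1}$ (indices mod $n$) and $u_iv_i$ for $1\le i\le n$. A list assignment $L$ assigns to each vertex $v$ a set $L(v)$ of colors; it is $k$-uniform if $|L(v)|=k$ for all $v$. A proper $L$-coloring is a proper vertex coloring $c$ with $c(v)\in L(v)$ for all $v$. A graph $G$ is equitably $k$-choosable if for every $k$-uniform list assignment $L$ of $G$ there is a proper $L$-coloring in which each color is used on at most $\lceil |V(G)|/k\rceil$ vertices. *)

(* Defs.v *)
From mathcomp Require Import all_boot finmap.

Set Implicit Arguments.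
Unset Strict Implicit.
Unset Printing Implicit Defensive.

Record sgraph := SGraph {
  svertex :> finType;
  sedge : rel svertex;
  sedge_sym : symmetric sedge;
  sedge_irr : irreflexive sedge }.

Definition cycle_rel n : rel 'I_n :=
  fun i j => (i != j) && ((j == ordS i) || (i == ordS j)).

Lemma cycle_rel_sym n : symmetric (@cycle_rel n).
Proof. by move=> i j; rewrite /cycle_rel eq_sym orbC. Qed.

Lemma cycle_rel_irr n : irreflexive (@cycle_rel n).
Proof. by move=> i; rewrite /cycle_rel eqxx. Qed.

(* [ordS] is the successor modulo n; the clause [i != j] of [cycle_rel] only
   removes a loop when n = 1. *)
Definition cycle_graph n : sgraph :=
  SGraph (@cycle_rel_sym n) (@cycle_rel_irr n).

Definition complete_rel n : rel 'I_n := fun i j => i != j.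

Lemma complete_rel_sym n : symmetric (@complete_rel n).
Proof. by move=> i j; rewrite /complete_rel eq_sym. Qed.

Lemma complete_rel_irr n : irreflexive (@complete_rel n).
Proof. by move=> i; rewrite /complete_rel eqxx. Qed.

Definition complete_graph n : sgraph :=
  SGraph (@complete_rel_sym n) (@complete_rel_irr n).

Definition cartesian_rel (G H : sgraph) : rel (G * H)%type :=
  fun p q => (p.1 == q.1) && sedge p.2 q.2 || (p.2 == q.2) && sedge p.1 q.1.

Lemma cartesian_rel_sym G H : symmetric (@cartesian_rel G H).
Proof.
move=> p q; rewrite /cartesian_rel (eq_sym p.1) (eq_sym p.2).
by rewrite (sedge_sym p.1) (sedge_sym p.2).
Qed.

Lemma cartesian_rel_irr G H : irreflexive (@cartesian_rel G H).
Proof. by move=> p; rewrite /cartesian_rel !sedge_irr !andbF. Qed.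

Definition cartesian_product (G H : sgraph) : sgraph :=
  SGraph (@cartesian_rel_sym G H) (@cartesian_rel_irr G H).

(* The vertices (i, 0) are the u_i and the vertices (i, 1) are the v_i, with i
   counted from 0. *)
Definition prism n : sgraph :=
  cartesian_product (cycle_graph n) (complete_graph 2).

Section ListColoring.

Variables (G : sgraph) (C : choiceType) (L : G -> {fset C}).

Definition uniform (k : nat) : Prop := forall v, #|` L v| = k.

Definition proper_list_coloring (c : G -> C) : Prop :=
  (forall u v, sedge u v -> c u <> c v) /\ (forall v, (c v \in L v)%fset).

End ListColoring.

(* For k > 0, this is the ceiling of m / k. *)
Definition ceil_div (m k : nat) : nat := (m + k.-1) %/ k.

Definition equitably_choosable (k : nat) (G : sgraph) : Prop :=
  forall (C : choiceType) (L : G -> {fset C}), uniform L k ->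
  exists c : G -> C, proper_list_coloring L c /\
    forall x : C, #|[set v | c v == x]| <= ceil_div #|G| k.

(* Main.v *)
(** List the vertices as [u_0, v_0, u_1, v_1, ...]. Coloring greedily so that
    each vertex avoids the colors of its two predecessors is always possible
    with lists of size 3; it is proper on the ladder and makes any three
    consecutive vertices rainbow, so each color is used at most [q] times on the
    first [3q] vertices. It remains to close up the cycle on a short tail whose
    lists have lost the colors of the neighbors already colored: a tail of 4
    vertices if n = 2 mod 3, of 5 if n = 1 mod 3, and of 6 if n = 0 mod 3. The
    first two always work. For the last one, if two consecutive vertices of one
    of the two cycles have different lists, the first vertex can be given a color
    missing from the list of its neighbor in the tail, and this suffices (when
    n = 3 the tail is everything, and a greedy coloring works); if the lists are
    constant on each of the two cycles, a coloring of period 3 is equitable. *)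
Require Import Defs.
From mathcomp Require Import all_boot finmap.
From mathcomp Require Import zify.

Set Implicit Arguments.
Unset Strict Implicit.
Unset Printing Implicit Defensive.

Ltac neq := first [assumption | rewrite eq_sym; assumption
  | apply/andP; split; neq | apply/orP; left; neq | apply/orP; right; neq].

Ltac neqs := repeat split; neq.

(** * Greedy choices from lists, and color counts *)

Section Choices.

Variable C : eqType.
Implicit Types (A B D E F G : seq C) (s : seq C) (x y : C).

(** Equivalent to [A] having at least [k] distinct entries, phrased as a greedy choice uses it. *)
Definition choices k A :=
  forall s, size s < k -> exists2 x, x \in A & x \notin s.

Lemma choices_uniq A : uniq A -> choices (size A) A.
Proof.
move=> uA s ltsA; apply/allPn; apply: contraTN ltsA => /allP sAs.
by rewrite -leqNgt uniq_leq_size.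
Qed.

Lemma choices_remove k A x : choices k.+1 A -> choices k [seq y <- A | y != x].
Proof.
move=> chA s lts; have [|y yA] := chA (x :: s); first by rewrite /= ltnS.
rewrite inE negb_or => /andP[yx ys]; exists y => //.
by rewrite mem_filter yx.
Qed.

Lemma choices_avoid1 k A x : choices k A -> 1 < k ->
  exists2 z, z \in A & z != x.
Proof.
by move=> chA lt1k; have [z zA] := chA [:: x] lt1k; rewrite inE; exists z.
Qed.

Lemma choices_avoid2 k A x y : choices k A -> 2 < k ->
  exists z, [/\ z \in A, z != x & z != y].
Proof.
move=> chA lt2k; have [z zA] := chA [:: x; y] lt2k.
by rewrite !inE negb_or => /andP[zx zy]; exists z.
Qed.

Lemma choices_greedy (l : nat -> seq C) p : (forall k, choices 3 (l k)) ->
  p \in l 0 ->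
  exists w : nat -> C,
    [/\ w 0 = p, forall k, w k \in l k, forall k, w k != w k.+1
      & forall k, w k != w k.+2].
Proof.
move=> chl pl0.
pose next A y z := head p [seq x <- A | x \notin [:: y; z]].
have nextP k y z : [/\ next (l k) y z \in l k, y != next (l k) y z
                     & z != next (l k) y z].
  have: next (l k) y z \in [seq x <- l k | x \notin [:: y; z]].
    rewrite /next; have [x xl xs] := chl k [:: y; z] isT.
    have: x \in [seq x <- l k | x \notin [:: y; z]] by rewrite mem_filter xs.
    by case: [seq _ <- _ | _] => //= a s _; rewrite mem_head.
  rewrite mem_filter !inE negb_or => /andP[/andP[ny nz] ->].
  by rewrite eq_sym ny eq_sym nz.
(* The state holds the last two colors; starting from [(p, p)] makes the second vertex avoid [p]. *)
pose fix st k := if k is k'.+1 then ((st k').2, next (l k) (st k').1 (st k').2)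
                 else (p, p).
exists (fun k => (st k).2); split=> //= [[|k]|k|k] //=.
- by have [] := nextP k.+1 (st k).1 (st k).2.
- by have [] := nextP k.+1 (st k).1 (st k).2.
- by have [] := nextP k.+2 (st k).2 (next (l k.+1) (st k).1 (st k).2).
Qed.

Lemma count_neq x y z : y != z -> (y == x) + (z == x) <= 1.
Proof.
by case: (eqVneq y x) => [->|_]; case: (eqVneq z x) => // ->; rewrite eqxx.
Qed.

Lemma count_neq_or x y z t :
  (y != z) || (y != t) -> (y == x) + (z == x) + (t == x) <= 2.
Proof. by case/orP=> /(count_neq x); case: eqP; case: eqP; case: eqP. Qed.

Lemma count_rainbow (w : nat -> C) x q :
  (forall k, w k != w k.+1) -> (forall k, w k != w k.+2) ->
  count (fun k => w k == x) (iota 0 (3 * q)) <= q.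
Proof.
move=> w1 w2; elim: q => [|q IHq]; first by rewrite muln0.
rewrite mulnSr iotaD count_cat add0n -[X in _ <= X]addn1 leq_add //=.
have := count_neq x (w1 (3 * q)); have := count_neq x (w1 (3 * q).+1).
have := count_neq x (w2 (3 * q)); lia.
Qed.

(** * Coloring the tails *)

(* The 4-cycle [a b e d] is 2-choosable; moreover the opposite vertices [a] and
   [e] need not both receive a given color [z]. *)
Lemma color_square z A B D E :
  choices 2 A -> choices 2 B -> choices 2 D -> choices 2 E ->
  exists a b d e, [/\ a \in A, b \in B, d \in D, e \in E
    & [/\ a != b, d != e, a != d, b != e & (a != z) || (e != z)]].
Proof.
move=> chA chB chD chE.
have [a aA az] := choices_avoid1 z chA isT.
have [e eE ez] := choices_avoid1 z chE isT.
(* If [a] is not in [D], the edge [ad] takes care of itself and the path [a], [b], [e], [d] is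
   colored greedily; likewise with [B]. *)
have [aD|aD] := boolP (a \in D); last first.
  have [b bB ba] := choices_avoid1 a chB isT.
  have [e' e'E e'b] := choices_avoid1 b chE isT.
  have [d dD de] := choices_avoid1 e' chD isT.
  have ad : a != d by apply: contraNneq aD => ->.
  by exists a, b, d, e'; neqs.
have [aB|aB] := boolP (a \in B); last first.
  have [d dD da] := choices_avoid1 a chD isT.
  have [e' e'E e'd] := choices_avoid1 d chE isT.
  have [b bB be] := choices_avoid1 e' chB isT.
  have ab : a != b by apply: contraNneq aB => ->.
  by exists a, b, d, e'; neqs.
(* Now [a] is in both [B] and [D]. If [e] equals [a], its two neighbors only have to avoid that
   color; otherwise both of them receive [a]. *)
have [ae|ae] := eqVneq a e.
  have [b bB ba] := choices_avoid1 a chB isT.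
  have [d dD da] := choices_avoid1 a chD isT.
  by exists a, b, d, e; rewrite -ae in eE ez *; neqs.
have [a' a'A a'a] := choices_avoid1 a chA isT.
by exists a', a, a, e; neqs.
Qed.

(* The ladder with rungs [ab], [de], [fg]. In a proper coloring a color is used
   three times only on one of the independent triples [aef] and [bdg]. *)
Definition ladder3_colorable A B D E F G := exists a b d e f g,
  [/\ [/\ a \in A, b \in B, d \in D, e \in E & f \in F], g \in G,
      [/\ a != b, d != e & f != g], [/\ a != d, b != e, d != f & e != g]
    & ((e != a) || (e != f)) && ((b != d) || (b != g))].

Lemma color_ladder3 A B D E F G :
  choices 2 A -> choices 2 B -> choices 3 D -> choices 3 E -> choices 3 F ->
  choices 2 G -> ladder3_colorable A B D E F G.
Proof.
move=> chA chB chD chE chF chG.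
have [/hasP[y yG yD]|/hasPn GD] := boolP (has [in D] G); last first.
  have [a aA _] := chA [::] isT.
  have [b bB ba] := choices_avoid1 a chB isT.
  have [e [eE ea eb]] := choices_avoid2 a b chE isT.
  have [d [dD da de]] := choices_avoid2 a e chD isT.
  have [g gG ge] := choices_avoid1 e chG isT.
  have [f [fF fd fg]] := choices_avoid2 d g chF isT.
  have gd : g != d by apply: contraTneq dD => <-; apply: GD.
  have bdg : (b != d) || (b != g).
    by have [->|//] := eqVneq b d; rewrite eq_sym gd orbT.
  by exists a, b, d, e, f, g; neqs.
(* A common color [u] goes on both [d] and [g]; then [e != f] and [b != u] settle the two
   triples. *)
have common u a b : u \in G -> u \in D -> a \in A -> b \in B ->
    a != u -> b != u -> a != b -> ladder3_colorable A B D E F G.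
  move=> uG uD aA bB au bu ab.
  have [e [eE eu eb]] := choices_avoid2 u b chE isT.
  have [f [fF fu fe]] := choices_avoid2 u e chF isT.
  by exists a, b, u, e, f, u; neqs.
have [a aA ay] := choices_avoid1 y chA isT.
have [b bB b_y] := choices_avoid1 y chB isT.
have [ab|ab] := eqVneq a b; last exact: (common y a b).
subst b.
have [a' a'A a'a] := choices_avoid1 a chA isT.
have [a'y|a'y] := eqVneq a' y; last exact: (common y a' a).
have [b' b'B b'a] := choices_avoid1 a chB isT.
have [b'y|b'y] := eqVneq b' y; last by apply: (common y a b'); neq.
subst a' b'.
(* From here on [a] and [y] lie in both [A] and [B]. The scheme [pick] fails only when its choices
   for [e] and [f] are both forced to be [a]. *)
have [d [dD dy da]] := choices_avoid2 y a chD isT.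
have pick e f : e \in E -> f \in F -> e != y -> e != d -> f != y -> f != d ->
    (e != a) || (e != f) -> ladder3_colorable A B D E F G.
  by move=> eE fF ey ed fy fd eaf; exists a, y, d, e, f, y; neqs.
have [e [eE ey ed]] := choices_avoid2 y d chE isT.
have [f [fF fy fd]] := choices_avoid2 y d chF isT.
have [ea0|ea0] := eqVneq e a; last by apply: (pick e f); neq.
subst e.
have [fa0|fa0] := eqVneq f a; last by apply: (pick a f); neq.
subst f.
have [e [eE' ey' ea]] := choices_avoid2 y a chE isT.
have [ed0|ed0] := eqVneq e d; last by apply: (pick e a); neq.
subst e.
have [e [eE'' ed' ea']] := choices_avoid2 d a chE isT.
have [ey0|ey0] := eqVneq e y; last by apply: (pick e a); neq.
subst e.
have [f [fF' fy' fa]] := choices_avoid2 y a chF isT.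
have [fd0|fd0] := eqVneq f d; last by apply: (pick a f); neq.
subst f.
(* What remains has [a], [d], [y] in [E] and [a], [d] in [F], which allows an explicit coloring for
   each choice of [g]. *)
have [g gG' gy] := choices_avoid1 y chG isT.
have [ga|ga] := eqVneq g a; last by exists y, a, d, y, a, g; neqs.
subst g.
by exists a, y, y, d, d, a; neqs.
Qed.

(** * Closing up the cycle in the linear numbering *)

(* The vertices u_0, v_0, u_1, v_1, ... of the prism are numbered 0, 1, 2, ... *)
Definition prism_coloring (l : nat -> seq C) n (w : nat -> C) :=
  [/\ forall k, k < n.*2 -> w k \in l k,
      forall k, k.*2.+1 < n.*2 -> w k.*2 != w k.*2.+1,
      forall k, k.+2 < n.*2 -> w k != w k.+2,
      w (n.*2 - 2) != w 0 /\ w (n.*2 - 1) != w 1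
    & forall x, count (fun k => w k == x) (iota 0 n.*2) <= ceil_div n.*2 3].

(** The prefix consists of [q] whole rainbow triples, so the bounds for prefix and tail add up
    exactly. For odd [q] the cut splits a rung, whence the extra condition on the first tail
    vertex. *)
Lemma prism_coloring_glue l n q w z t :
  n.*2 = 3 * q + size t -> 0 < q -> 1 < size t ->
  (forall k, w k \in l k) -> (forall k, w k != w k.+1) ->
  (forall k, w k != w k.+2) ->
  (forall j, j < size t -> nth z t j \in l (3 * q + j)) ->
  (odd q -> w (3 * q - 1) != nth z t 0) ->
  (forall j, j.+1 < size t -> ~~ odd (3 * q + j) ->
    nth z t j != nth z t j.+1) ->
  w (3 * q - 2) != nth z t 0 -> w (3 * q - 1) != nth z t 1 ->
  (forall j, j.+2 < size t -> nth z t j != nth z t j.+2) ->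
  nth z t (size t - 2) != w 0 -> nth z t (size t - 1) != w 1 ->
  (forall x, count_mem x t <= ceil_div (size t) 3) ->
  exists w', prism_coloring l n w'.
Proof.
move=> Dn q0 t1 wl w1 w2 tl wt' tt' wt0 wt1 tt tw0 tw1 tc.
have [M DM] : {M | M = 3 * q} by exists (3 * q).
rewrite -DM in Dn tl tt' wt' wt0 wt1.
pose W k := if k < M then w k else nth z t (k - M).
have Wlt k : k < M -> W k = w k by rewrite /W => ->.
have Wge j : W (M + j) = nth z t j.
  by rewrite /W ltnNge leq_addr addKn.
exists W; rewrite /prism_coloring Dn; split.
- move=> k; have [ltkM _|/subnKC <-] := ltnP k M; first by rewrite Wlt.
  by rewrite ltn_add2l Wge; apply: tl.
- move=> k; have [ltkM _|] := ltnP k.*2.+1 M; first by rewrite !Wlt // ltnW.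
  rewrite leq_eqVlt => /orP[/eqP Mk|leMk] ltk.
    rewrite Wlt; last by rewrite Mk.
    have -> : k.*2 = M - 1 by lia.
    have -> : (M - 1).+1 = M + 0 by lia.
    rewrite Wge wt' //; lia.
  have Dk : k.*2 = M + (k.*2 - M) by lia.
  rewrite Dk -addnS !Wge tt' -?Dk ?odd_double //; lia.
- move=> k; have [ltkM _|] := ltnP k.+2 M; first by rewrite !Wlt //; lia.
  move=> leMk2 ltk; have [ltkM|leMk] := ltnP k M.
    rewrite Wlt //.
    have [kM|kM] : k = M - 2 \/ k = M - 1 by lia.
      have -> : k.+2 = M + 0 by lia.
      by rewrite Wge kM.
    have -> : k.+2 = M + 1 by lia.
    by rewrite Wge kM.
  have -> : k = M + (k - M) by lia.
  rewrite -!addnS !Wge; apply: tt; lia.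
- rewrite -!addnBA ?(ltnW t1) // !Wge !Wlt //; lia.
- move=> x; rewrite iotaD count_cat add0n /ceil_div DM mulnC -addnA divnMDl //.
  rewrite leq_add //.
    rewrite (@eq_in_count _ _ (fun k => w k == x)).
      by rewrite mulnC count_rainbow.
    by move=> k; rewrite mem_iota add0n /= mulnC -DM => /Wlt ->.
  apply: leq_trans (tc x).
  rewrite mulnC -DM -[X in iota X]addn0 iotaDl count_map.
  rewrite -{2}[t](mkseq_nth z) /mkseq count_map leq_eqVlt; apply/orP; left.
  by apply/eqP/eq_count => j /=; rewrite Wge.
Qed.

(** Each vertex of the tail square has exactly one neighbor in the prefix, so two colors remain; the
    two rungs use a color at most twice. *)
Lemma prism_coloring_mod2 l m : (forall k, choices 3 (l k)) -> 0 < m ->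
  exists w, prism_coloring l (3 * m + 2) w.
Proof.
move=> chl m0; have [p pl _] := chl 0 [::] isT.
have [w [_ wl w1 w2]] := choices_greedy chl pl.
have DM : (3 * m + 2).*2 = 3 * m.*2 + 4 by lia.
pose M := 3 * m.*2.
have [a [b [d [e [aA bB dD eE [ab de ad be _]]]]]] := color_square p
  (choices_remove (w (M - 2)) (chl (M + 0)))
  (choices_remove (w (M - 1)) (chl (M + 1)))
  (choices_remove (w 0) (chl (M + 2))) (choices_remove (w 1) (chl (M + 3))).
move: aA bB dD eE; rewrite !mem_filter.
move=> /andP[aw aA] /andP[bw bB] /andP[dw dD] /andP[ew eE].
apply: (@prism_coloring_glue l _ m.*2 w p [:: a; b; d; e]) => //=.
- by rewrite double_gt0.
- by do 4?[case=> //].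
- by rewrite odd_double.
- by do 4?[case=> //]; rewrite oddD oddM odd_double.
- by rewrite eq_sym.
- by rewrite eq_sym.
- by do 4?[case=> //].
move=> x; have := count_neq x ab; have := count_neq x de.
by rewrite /ceil_div /=; case: (a == x); case: (b == x); case: (d == x);
  case: (e == x).
Qed.

(** The tail starts in the middle of a rung, with [c]. Only the triple [c], [a], [e] is independent,
    and [color_square] with [z := c] rules out its having one color. *)
Lemma prism_coloring_mod1 l m : (forall k, choices 3 (l k)) -> 0 < m ->
  exists w, prism_coloring l (3 * m + 1) w.
Proof.
move=> chl m0; have [p pl _] := chl 0 [::] isT.
have [w [_ wl w1 w2]] := choices_greedy chl pl.
have [DM q0] : (3 * m + 1).*2 = 3 * m.*2.-1 + 5 /\ 0 < m.*2.-1 by lia.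
pose M := 3 * m.*2.-1.
have [c [cC c2 c1]] := choices_avoid2 (w (M - 2)) (w (M - 1)) (chl (M + 0)) isT.
have [a [b [d [e [aA bB dD eE [ab de ad be ace]]]]]] := color_square c
  (choices_remove (w (M - 1)) (chl (M + 1)))
  (choices_remove c (chl (M + 2)))
  (choices_remove (w 0) (chl (M + 3))) (choices_remove (w 1) (chl (M + 4))).
move: aA bB dD eE; rewrite !mem_filter.
move=> /andP[aw aA] /andP[bc bB] /andP[dw dD] /andP[ew eE].
have oM : odd m.*2.-1 by rewrite -subn1 oddB ?double_gt0 // odd_double.
apply: (@prism_coloring_glue l _ m.*2.-1 w p [:: c; a; b; d; e]) => //=.
- by do 5?[case=> //].
- by rewrite eq_sym.
- by do 4?[case=> //]; rewrite oddD oddM oM.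
- by rewrite eq_sym.
- by rewrite eq_sym.
- by do 4?[case=> //]; rewrite eq_sym.
move=> x; have := count_neq x ab; have := count_neq x de.
have := count_neq x bc; have := count_neq x ad; have := count_neq x be.
rewrite (eq_sym a) (eq_sym e) in ace; have := count_neq_or x ace.
by rewrite /ceil_div /=; case: (c == x); case: (a == x); case: (b == x);
  case: (d == x); case: (e == x).
Qed.

Lemma prism_coloring_mod0 l m : (forall k, choices 3 (l k)) -> 1 < m ->
  (exists2 p, p \in l 0 & p \notin l ((3 * m).*2 - 2)) ->
  exists w, prism_coloring l (3 * m) w.
Proof.
move=> chl m1 [p pl pl'].
have [w [w0 wl w1 w2]] := choices_greedy chl pl.
have [DM q0] : (3 * m).*2 = 3 * (m - 1).*2 + 6 /\ 0 < (m - 1).*2 by lia.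
pose M := 3 * (m - 1).*2.
(* The list of [f] stays whole: its neighbor at position 0 has color [p], which that list lacks. *)
have [a [b [d [e [f [g [[aA bB dD eE fF] gG [ab de fg] [ad be df eg]]]]]]]] :=
  color_ladder3
  (choices_remove (w (M - 2)) (chl (M + 0)))
  (choices_remove (w (M - 1)) (chl (M + 1))) (chl (M + 2)) (chl (M + 3))
  (chl (M + 4)) (choices_remove (w 1) (chl (M + 5))).
move=> /andP[eaf bdg].
move: aA bB gG; rewrite !mem_filter => /andP[aw aA] /andP[bw bB] /andP[gw gG].
apply: (@prism_coloring_glue l _ (m - 1).*2 w p [:: a; b; d; e; f; g]) => //=.
- by do 6?[case=> //].
- by rewrite odd_double.
- by do 6?[case=> //]; rewrite oddD oddM odd_double.
- by rewrite eq_sym.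
- by rewrite eq_sym.
- by do 6?[case=> //].
- rewrite w0; apply: contraNneq pl' => <-.
  by rewrite DM -addnBA.
move=> x; have := count_neq x ab; have := count_neq x de.
have := count_neq x fg; have := count_neq x ad; have := count_neq x be.
have := count_neq x df; have := count_neq x eg.
have := count_neq_or x eaf; have := count_neq_or x bdg.
rewrite /ceil_div /=; case: (a == x); case: (b == x); case: (d == x) => //=;
  by case: (e == x); case: (f == x); case: (g == x).
Qed.

(** Greedy in the order [a], [b], [e], [d], [g], [f]: the last vertex has three colored neighbors,
    but the color of [a] is not in its list. The triangles [adf] and [beg] each use a color at most
    once. *)
Lemma prism_coloring_3 l : (forall k, choices 3 (l k)) ->
  (exists2 p, p \in l 0 & p \notin l 4) -> exists w, prism_coloring l 3 w.
Proof.
move=> chl [a aA aF].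
have [b bB ba] := choices_avoid1 a (chl 1) isT.
have [e eE eb] := choices_avoid1 b (chl 3) isT.
have [d [dD da de]] := choices_avoid2 a e (chl 2) isT.
have [g [gG gb ge]] := choices_avoid2 b e (chl 5) isT.
have [f [fF fd fg]] := choices_avoid2 d g (chl 4) isT.
have fa : f != a by apply: contraNneq aF => <-.
exists (nth a [:: a; b; d; e; f; g]); split=> //.
- by do 6?[case=> //].
- by do 6?[case=> //] => _; neq.
- by do 6?[case=> //] => _; neq.
move=> x; have := count_neq x da; have := count_neq x fd; have := count_neq x fa.
have := count_neq x eb; have := count_neq x gb; have := count_neq x ge.
rewrite /ceil_div /=; case: (a == x); case: (b == x); case: (d == x) => //=;
  by case: (e == x); case: (f == x); case: (g == x).
Qed.

(** * Lists constant on each cycle *)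

Lemma choices3_elim A : choices 3 A ->
  exists x y z, [/\ x \in A, y \in A, z \in A & [/\ x != y, x != z & y != z]].
Proof.
move=> chA; have [x xA _] := chA [::] isT.
have [y yA yx] := choices_avoid1 x chA isT.
have [z [zA zx zy]] := choices_avoid2 x y chA isT.
by exists x, y, z; neqs.
Qed.

(** Each [x] equals at most one [z] and conversely, so being different admits a perfect matching;
    the cases are enumerated. *)
Lemma choices3_match x1 x2 x3 B :
    [/\ x1 != x2, x1 != x3 & x2 != x3] -> choices 3 B ->
  exists y1 y2 y3, [/\ [/\ y1 \in B, y2 \in B & y3 \in B],
    [/\ y1 != y2, y1 != y3 & y2 != y3] & [/\ x1 != y1, x2 != y2 & x3 != y3]].
Proof.
move=> [x12 x13 x23] /choices3_elim[z1 [z2 [z3 [z1B z2B z3B [z12 z13 z23]]]]].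
pose apart y1 y2 y3 := [&& x1 != y1, x2 != y2 & x3 != y3].
have : [|| apart z1 z2 z3, apart z1 z3 z2, apart z2 z1 z3, apart z2 z3 z1,
           apart z3 z1 z2 | apart z3 z2 z1].
  move: (count_neq z1 x12) (count_neq z1 x13) (count_neq z1 x23).
  move: (count_neq z2 x12) (count_neq z2 x13) (count_neq z2 x23).
  move: (count_neq z3 x12) (count_neq z3 x13) (count_neq z3 x23).
  move: (count_neq x1 z12) (count_neq x1 z13) (count_neq x1 z23).
  move: (count_neq x2 z12) (count_neq x2 z13) (count_neq x2 z23).
  move: (count_neq x3 z12) (count_neq x3 z13) (count_neq x3 z23).
  rewrite /apart !(eq_sym z1) !(eq_sym z2) !(eq_sym z3).
  case: (x1 == z1); case: (x1 == z2); case: (x1 == z3) => //=;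
  case: (x2 == z1); case: (x2 == z2); case: (x2 == z3) => //=;
  by case: (x3 == z1); case: (x3 == z2); case: (x3 == z3).
by do 5?[case/orP]; move=> /and3P[n1 n2 n3];
  [exists z1, z2, z3 | exists z1, z3, z2 | exists z2, z1, z3
  | exists z2, z3, z1 | exists z3, z1, z2 | exists z3, z2, z1]; neqs.
Qed.

Lemma prism_coloring_const l m : (forall k, choices 3 (l k)) -> 0 < m ->
  (forall k, k < 3 * m -> l k.*2 = l 0 /\ l k.*2.+1 = l 1) ->
  exists w, prism_coloring l (3 * m) w.
Proof.
move=> chl m0 lconst.
have D6 : (3 * m).*2 = m * 6 by lia.
have C6 : ceil_div (m * 6) 3 = m * 2 by rewrite /ceil_div; lia.
have [N4 N5] : (m * 6 - 2) %% 6 = 4 /\ (m * 6 - 1) %% 6 = 5 by lia.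
have lodd k : k < m * 6 -> l k = l (odd k).
  move=> ltk; have [] := lconst k./2; first by lia.
  move=> le le1; rewrite -[k]odd_double_half oddD odd_double addbF oddb.
  by case: (odd k); rewrite ?add1n ?add0n.
have double6 k : k.*2.+1 %% 6 = (k.*2 %% 6).+1 by lia.
have [a [d [f [aA dA fA dis]]]] := choices3_elim (chl 0).
have [b [e [g [[bB eB gB] [be bg eg] [ab de fg]]]]] :=
  choices3_match dis (chl 1).
have [ad af df] := dis.
(* Period 3 along the cycles is period 6 in the numbering; a period uses a color at most once on
   each cycle. *)
pose t := [:: a; b; d; e; f; g].
exists (fun k => nth a t (k %% 6)); rewrite /prism_coloring D6; split.
- move=> k /lodd ->; have <- : odd (k %% 6) = odd k by rewrite odd_mod.
  have := @ltn_pmod k 6 isT; move: (k %% 6).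
  by do 6?[case=> //].
- move=> k _; rewrite double6; have := @ltn_pmod k.*2 6 isT.
  have: ~~ odd (k.*2 %% 6) by rewrite odd_mod // odd_double.
  by move: (k.*2 %% 6); do 6?[case=> //].
- move=> k _; rewrite -[k.+2]addn2 -modnDml.
  have := @ltn_pmod k 6 isT; move: (k %% 6).
  by do 6?[case=> //] => _; neq.
- by rewrite N4 N5 /=; neqs.
move=> x; rewrite C6; elim: (m) => // q IHq.
rewrite !mulSnr iotaD count_cat leq_add // -[X in iota X]addn0 iotaDl count_map.
rewrite (@eq_count _ _ (fun k => nth a t (k %% 6) == x)) /=; last first.
  by move=> k /=; rewrite add0n modnMDl.
have := count_neq x ab; have := count_neq x de.
have := count_neq x fg; have := count_neq x ad; have := count_neq x be.
have := count_neq x df; have := count_neq x eg.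
have := count_neq x af; have := count_neq x bg.
by case: (a == x); case: (b == x); case: (d == x); case: (e == x);
  case: (f == x); case: (g == x).
Qed.

Lemma prism_coloring_exists l n : (forall k, choices 3 (l k)) -> 2 < n ->
  (exists2 p, p \in l 0 & p \notin l (n.*2 - 2)) \/
    (forall k, k < n -> l k.*2 = l 0 /\ l k.*2.+1 = l 1) ->
  exists w, prism_coloring l n w.
Proof.
move=> chl n2 lP.
have [m [m0 [Dn|[Dn|Dn]]]] :
    exists m, 0 < m /\ (n = 3 * m \/ n = 3 * m + 1 \/ n = 3 * m + 2).
  by exists (n %/ 3); lia.
- rewrite {}Dn in lP n2 *; case: lP => [lP|]; last exact: prism_coloring_const.
  have [m1|m1] := ltnP 1 m; first exact: prism_coloring_mod0.
  have m1' : m = 1 by lia.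
  by subst m; apply: prism_coloring_3.
- by rewrite Dn; apply: prism_coloring_mod1.
- by rewrite Dn; apply: prism_coloring_mod2.
Qed.

End Choices.

(** * Transfer to the prism graph *)

Lemma ord2_eq (i j k : 'I_2) : (i == k) = (j == k) -> i = j.
Proof.
rewrite -!val_eqE /= => e; apply: val_inj => /=.
by have := ltn_ord i; have := ltn_ord j; have := ltn_ord k; lia.
Qed.

(* Rotating by [r] and exchanging the two cycles when [s] is 1 brings any vertex
   to position 0. *)
Definition prism_index n (r : nat) (s : 'I_2) (v : prism n) : nat :=
  ((v.1 + r) %% n).*2 + (v.2 != s).

Section PrismIndex.

Variables (n r : nat) (s : 'I_2).
Hypothesis n_gt2 : 2 < n.

Let n_gt0 : 0 < n. Proof. exact: ltnW (ltnW n_gt2). Qed.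

Lemma prism_index_lt (v : prism n) : prism_index r s v < n.*2.
Proof.
have := ltn_pmod (v.1 + r) n_gt0; rewrite /prism_index.
by move: (_ %% n) => k; case: (_ != _); lia.
Qed.

Lemma prism_index_inj : injective (@prism_index n r s).
Proof.
move=> [i a] [j b]; rewrite /prism_index /= => e.
have {e} [e1 e2] : (i + r) %% n = (j + r) %% n /\ (a == s) = (b == s).
  move: e; move: (_ %% n) (_ %% n) => k1 k2.
  by case: (a == s); case: (b == s); lia.
congr (_, _); last exact: ord2_eq e2.
apply: val_inj; move/eqP: e1; rewrite eqn_modDr => /eqP.
by rewrite !modn_small.
Qed.

Lemma prism_index_ordS (i : 'I_n) a :
  (prism_index r s (i, a)).+2 < n.*2 /\
    prism_index r s (ordS i, a) = (prism_index r s (i, a)).+2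
  \/ prism_index r s (i, a) = n.*2 - 2 + (a != s)
    /\ prism_index r s (ordS i, a) = (a != s).
Proof.
rewrite /prism_index /=.
have -> : (i.+1 %% n + r) %% n = ((i + r) %% n).+1 %% n.
  by rewrite modnDml addSn -addn1 -modnDml addn1.
have := ltn_pmod (i + r) n_gt0; move: (_ %% n) => k.
rewrite leq_eqVlt => /predU1P[<-|ltk].
  by right; rewrite modnn doubleS subn2.
left; rewrite (modn_small ltk); case: (_ != _); lia.
Qed.

Lemma prism_coloring_transfer (C : choiceType) (L : prism n -> {fset C})
    (l : nat -> seq C) w :
  (forall v, l (prism_index r s v) = L v) -> prism_coloring l n w ->
  exists c : prism n -> C, proper_list_coloring L c /\
    forall x : C, #|[set v | c v == x]| <= ceil_div #|prism n| 3.
Proof.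
move=> lL [wl wr w2 [we0 we1] wc]; exists (w \o prism_index r s).
split; last first.
  move=> x; rewrite card_prod !card_ord muln2; apply: leq_trans (wc x).
  (* The index maps a color class injectively into the positions of that color. *)
  rewrite cardE -(size_map (prism_index r s)) -size_filter uniq_leq_size //.
    by rewrite map_inj_uniq ?enum_uniq //; apply: prism_index_inj.
  move=> k /mapP[v]; rewrite mem_enum inE => /= vx ->.
  by rewrite mem_filter vx mem_iota prism_index_lt.
split=> [u v|v]; last by have := wl _ (prism_index_lt v); rewrite lL.
have step (i : 'I_n) a :
    w (prism_index r s (i, a)) != w (prism_index r s (ordS i, a)).
  have [[lt2 ->]|[-> ->]] := prism_index_ordS i a; first exact: w2.
  case: (a != s); last by rewrite addn0.
  by have -> : n.*2 - 2 + 1 = n.*2 - 1 by lia.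
have rung (i : 'I_n) a b : b != a -> a == s ->
    w (prism_index r s (i, a)) != w (prism_index r s (i, b)).
  move=> ba /eqP as_; have bs : b != s by rewrite -as_.
  have := prism_index_lt (i, b).
  rewrite /prism_index /= as_ eqxx bs addn0 addn1; apply: wr.
case: u v => [i a] [j b] /= uv; apply/eqP; move: uv.
case/orP=> /andP[/= /eqP <-]; last first.
  by case/andP=> _ /orP[] /eqP ->; rewrite // eq_sym.
rewrite /complete_rel => ab; have [as_|as_] := boolP (a == s).
  by apply: rung => //; rewrite eq_sym.
have bs : b == s.
  apply: contraNT ab => bs; apply/eqP/(@ord2_eq _ _ s).
  by rewrite (negPf as_) (negPf bs).
by rewrite eq_sym; apply: rung.
Qed.

End PrismIndex.

Theorem theorem1p6 (n : nat) (hn : 3 <= n) : equitably_choosable 3 (prism n).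
Proof.
move=> C L uL; have n0 : 0 < n := ltnW (ltnW hn).
have chL v : choices 3 (L v) by rewrite -(uL v); apply/choices_uniq/fset_uniq.
(* The default is another list of size 3, so that [choices 3] holds at every position. *)
pose l r s (k : nat) : seq C :=
  if [pick v | @prism_index n r s v == k] is Some v then L v
  else L (Ordinal n0, ord0).
have lL r s v : l r s (prism_index r s v) = L v.
  rewrite /l; case: pickP => [u /eqP/(prism_index_inj hn)->//|/(_ v)].
  by rewrite eqxx.
have chl r s k : choices 3 (l r s k) by rewrite /l; case: pickP.
have [[i a] /= Li|Lconst] :=
  pickP (fun v : prism n => L v != L (ordS v.1, v.2)).
  (* This rotation puts [iS] at position 0 and its predecessor [(i, a)] at position [n.*2 - 2]. *)
  pose r := n - ordS i; pose iS : prism n := (ordS i, a).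
  have index0 : prism_index r a iS = 0.
    by rewrite /prism_index /= subnKC ?modnn ?eqxx // ltnW // ltn_pmod.
  have index_last : @prism_index n r a (i, a) = n.*2 - 2.
    by have [[_]|[->]] := prism_index_ordS r a hn i a;
      rewrite ?index0 ?eqxx ?addn0.
  have [|w /(prism_coloring_transfer hn (lL r a))//] :=
    prism_coloring_exists (chl r a) hn.
  have := lL r a iS; have := lL r a (i, a); rewrite index0 index_last => -> ->.
  (* Different lists of equal size are not included in one another. *)
  left; apply/fsubsetPn; apply: contra Li => LS.
  by rewrite eq_sym eqEfcard LS (uL iS) (uL (i, a)).
have [|w /(prism_coloring_transfer hn (lL 0 ord0))//] :=
  prism_coloring_exists (chl 0 ord0) hn.
have Lrow (a : 'I_2) (k : 'I_n) : L (k, a) = L (Ordinal n0, a).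
  case: k => k; elim: k => [|k IHk] ltk.
    by congr (L (_, _)); apply: val_inj.
  rewrite -(IHk (ltnW ltk)).
  have /negbFE/eqP -> := Lconst (Ordinal (ltnW ltk), a).
  by congr (L (_, _)); apply: val_inj; rewrite /= modn_small.
right=> k ltk.
have row (j : nat) (ltj : j < n) (a : 'I_2) :
    l 0 ord0 (j.*2 + (a != ord0)) = L (Ordinal n0, a).
  rewrite -(Lrow a (Ordinal ltj)) -(lL 0 ord0).
  by rewrite /prism_index /= addn0 modn_small.
have := row k ltk ord0; have := row k ltk ord_max.
have := row 0 n0 ord0; have := row 0 n0 ord_max.
by rewrite !addn0 !addn1 => -> -> -> ->.
Qed.
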